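(* Let $\tau$ be an infinite cardinal number, $X$ be a $\tau$-paracompact normal (Hausdorff) space, $E$ be a normed space with $d(E)\leq\tau$, and $\rho$ be the metric on $E$ generated by the norm of $E$. Then each open-convex-valued $\rho$-l.s.c. relation $\Phi:X\leadsto E$ has a continuous selection.
   Context: All topological spaces are assumed Hausdorff and all vector spaces are real. $d(E)$ denotes the density of $E$ (least cardinality of a dense subset). A space $X$ is $\tau$-paracompact if each open cover of $X$ of cardinality $\leq\tau$ has a locally finite open refinement (covering $X$). For a relation $\Phi\subset X\times Y$, $\Phi(x)=\{y\in Y:\langle x,y\rangle\in\Phi\}$; writing $\Phi:X\leadsto Y$ means that $\Phi(x)\neq\varnothing$ for every $x\in X$. Open-convex-valued means that each $\Phi(x)$ is an open convex set. For a metric space $(Y,\rho)$, $\mathbf{O}_\varepsilon(p)=\{y\in Y:\rho(y,p)<\varepsilon\}$ and, for $S\subset Y$, $\mathbf{O}_\varepsilon(S)=\bigcup_{p\in S}\mathbf{O}_\varepsilon(p)$. A relation $\Phi:X\leadsto Y$ is $\rho$-l.s.c. if for every $\varepsilon>0$, each point $p\in X$ is contained in an open set $V\subset X$ such that $\Phi(p)\subset\mathbf{O}_\varepsilon(\Phi(x))$ for every $x\in V$. A selection for $\Phi:X\leadsto Y$ is a map $f:X\to Y$ with $f(x)\in\Phi(x)$ for every $x\in X$. *)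

(* Defs.v *)
From HB Require Import structures.
From mathcomp Require Import all_boot all_order all_algebra.
From mathcomp Require Import all_classical all_reals all_analysis.
Set Implicit Arguments.
Unset Strict Implicit.
Unset Printing Implicit Defensive.
Import Order.TTheory GRing.Theory Num.Theory.
Import numFieldNormedType.Exports.
Local Open Scope classical_set_scope.
Local Open Scope ring_scope.
Local Open Scope card_scope.

(* Cardinal numbers are represented by types: the cardinal tau is |[set: tau]|,
   and comparisons of cardinals are the library's [#<=]. *)

(* [D] realizes the density d(E): it is a dense set of least cardinality. *)
Definition realizes_density (E : topologicalType) (D : set E) : Prop :=
  dense D /\ forall D' : set E, dense D' -> D #<= D'.

Definition density_le (E : topologicalType) (tau : Type) : Prop :=
  exists D : set E, realizes_density D /\ D #<= [set: tau].

Definition open_cover (X : topologicalType) (U : set (set X)) : Prop :=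
  U `<=` open /\ \bigcup_(A in U) A = [set: X].

Definition refines (X : Type) (V U : set (set X)) : Prop :=
  forall B, V B -> exists2 A, U A & B `<=` A.

Definition locally_finite (X : topologicalType) (V : set (set X)) : Prop :=
  forall x : X, exists2 W : set X, nbhs x W &
    finite_set [set B | V B /\ B `&` W !=set0].

Definition tau_paracompact (tau : Type) (X : topologicalType) : Prop :=
  forall U : set (set X), open_cover U -> U #<= [set: tau] ->
    exists V : set (set X), [/\ open_cover V, refines V U & locally_finite V].

(* A relation Phi between X and Y is encoded as the map x |-> Phi(x). *)
Definition nonempty_valued (X Y : Type) (Phi : X -> set Y) : Prop :=
  forall x, Phi x !=set0.

Definition open_convex_valued (X : Type) (R : realType) (E : normedModType R)
    (Phi : X -> set E) : Prop :=
  forall x, open (Phi x) /\ convex_set (Phi x).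

Section distance.
Context (R : realType) (Y : Type) (rho : Y -> Y -> R).

Definition O_ball (eps : R) (p : Y) : set Y := [set y | rho y p < eps].

Definition O_set (eps : R) (S : set Y) : set Y := \bigcup_(p in S) O_ball eps p.

Definition rho_lsc (X : topologicalType) (Phi : X -> set Y) : Prop :=
  forall eps : R, 0 < eps -> forall p : X, exists V : set X,
    [/\ open V, V p & forall x, V x -> Phi p `<=` O_set eps (Phi x)].

End distance.

Definition norm_metric (R : realType) (E : normedModType R) (x y : E) : R :=
  `|x - y|.

(* Cardinals are well-founded: a nonempty family of sets has a member of least
   cardinality.  Hence the density of a space is always realized. *)
Lemma least_card (E : Type) (F : set (set E)) : F !=set0 ->
  exists2 D, F D & forall D', F D' -> D #<= D'.
Proof.
move=> [A0 FA0].
pose P (S : set (set E -> E)) :=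
  (forall g A, S g -> F A -> A (g A)) /\
  (forall g h A, S g -> S h -> F A -> g A = h A -> g = h).
have [C CP Ctot|S [[Sin Sinj] Smax]] := @Zorn_bigcup _ P.
  split=> [g A [S CS Sg] FA|g h A [S CS Sg] [S' CS' Sh] FA gh].
    by have [SC _] := CP _ CS; exact: (SC _ _ Sg FA).
  have [SS'|S'S] := Ctot _ _ CS CS'.
    by have [_ inj] := CP _ CS'; exact: (inj _ _ _ (SS' _ Sg) Sh FA gh).
  by have [_ inj] := CP _ CS; exact: (inj _ _ _ Sg (S'S _ Sh) FA gh).
have [A FA AS] : exists2 A, F A & A `<=` (fun g => g A) @` S.
  apply: contrapT => noA.
  have nA A : F A -> exists a, A a /\ ~ ((fun g => g A) @` S) a.
    move=> FA; apply: contrapT => na; apply: noA; exists A => // a Aa.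
    by apply: contrapT => nSa; apply: na; exists a.
  have [a0 _] := nA _ FA0.
  have /choice[h hP] : forall A, exists a,
      F A -> A a /\ ~ ((fun g => g A) @` S) a.
    move=> A; have [FA|nFA] := pselect (F A); last by exists a0.
    by have [a ?] := nA _ FA; exists a.
  have hnew g A : S g -> F A -> g A <> h A.
    by move=> Sg FA gh; have [_] := hP _ FA; apply; exists g.
  apply: (Smax (S `|` [set h])).
    rewrite properEneq; split; last by move=> g; left.
    apply/eqP => SE; apply: (hnew h A0) => //.
    by rewrite SE; right.
  split=> [g A [Sg|->] FA|g k A [Sg|->] [Sk|->] FA gk //].
  - exact: (Sin _ _ Sg FA).
  - by have [] := hP _ FA.
  - exact: (Sinj _ _ _ Sg Sk FA gk).
  - by have := hnew _ _ Sg FA gk.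
  - by have := hnew _ _ Sk FA (esym gk).
exists A => // B FB.
apply: (@card_le_trans _ _ _ S); last first.
  have -> : (S #<= B) = ((fun g => g B) @` S #<= B).
    apply/esym/card_le_eql/inj_card_eq => g h; rewrite !inE => Sg Sh.
    exact: (Sinj _ _ _ Sg Sh FB).
  by apply: subset_card_le => _ [g Sg <-]; exact: (Sin _ _ Sg FB).
exact: card_le_trans (subset_card_le AS) (card_image_le _ _).
Qed.

Lemma density_leP (E : topologicalType) (tau : Type) :
  density_le E tau <-> exists2 D : set E, dense D & D #<= [set: tau].
Proof.
split=> [[D [[dD _] Dtau]]|[D dD Dtau]]; first by exists D.
have [|M dM minM] := @least_card E (@dense E); first by exists D.
by exists M; split; [split|exact: card_le_trans (minM _ dD) Dtau].
Qed.

(* Main.v *)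
Require Import Defs.
From mathcomp Require Import all_boot all_order all_algebra finmap.
From mathcomp Require Import all_classical all_reals all_analysis.
From mathcomp Require Import lra.
Set Implicit Arguments.
Unset Strict Implicit.
Unset Printing Implicit Defensive.
Import Order.TTheory GRing.Theory Num.Theory.
Import numFieldNormedType.Exports.
Local Open Scope classical_set_scope.
Local Open Scope ring_scope.

(** The values being open and convex, uniform lower semicontinuity makes every
    set O y = {x | y in Phi x} open: if the ball of radius r about y lies in
    Phi p and e < r, then for x near p that ball lies in the e-neighbourhood of
    the open convex set Phi x, and this forces y in Phi x
    ([open_convex_cancel], [lsc_open_convex_interior]).  Each value Phi x is
    open and nonempty, hence meets a dense set D with at most tau points, so the
    sets O y with y in D form an open cover of cardinality at most tau.  Take
    a locally finite open refinement V, choose for each A in V a point y_A with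
    A inside O y_A, and glue these constants with a partition of unity phi
    subordinate to V: f = \sum_A phi_A y_A.  It is a locally finite sum of
    continuous maps, and f x is a convex combination of points y_A with
    phi_A x > 0, all of which lie in the convex set Phi x.

    The partition of unity is the classical one for a locally finite open cover
    of a normal space: Zorn's lemma gives a shrinking of the cover
    ([shrinking]), Urysohn's lemma gives a bump function for each member,
    and the bumps are divided by their sum ([partition_of_unity]). *)

(** * Convex sets in normed spaces *)

Lemma convex_setP (R : realType) (E : normedModType R) (C : set E) :
  convex_set C -> forall (x y : E) (t : R), 0 <= t -> t <= 1 ->
  C x -> C y -> C (t *: x + (1 - t) *: y).
Proof.
move=> Ccvx x y t t0 t1 Cx Cy.
have := Ccvx x y (Itv01 t0 t1); rewrite !inE; exact.
Qed.

(** Weighted means of finitely many points stay in a convex set.  Dividing by the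
    total weight, instead of requiring it to be 1, lets the induction on the list
    of indices go through; points of weight 0 may lie outside the set. *)
Lemma convex_mean (R : realType) (E : normedModType R) (C : set E)
    (I : eqType) (r : seq I) (w : I -> R) (y : I -> E) :
  convex_set C -> (forall i, i \in r -> 0 <= w i) ->
  (forall i, i \in r -> 0 < w i -> C (y i)) ->
  0 < \sum_(i <- r) w i ->
  C ((\sum_(i <- r) w i)^-1 *: \sum_(i <- r) w i *: y i).
Proof.
move=> Ccvx; elim: r => [|i r IH] w0 Cy; first by rewrite big_nil ltxx.
have {}IH : 0 < \sum_(j <- r) w j ->
    C ((\sum_(j <- r) w j)^-1 *: \sum_(j <- r) w j *: y j).
  by apply: IH => j jr; [apply: w0|apply: Cy]; rewrite inE jr orbT.
have S0 : 0 <= \sum_(j <- r) w j.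
  by rewrite big_seq sumr_ge0// => j jr; apply: w0; rewrite inE jr orbT.
have wi0 : 0 <= w i by apply: w0; rewrite mem_head.
rewrite !big_cons; have [wi|] := eqVneq (w i) 0.
  by rewrite wi scale0r !add0r.
move=> win0; have {}wi0 : 0 < w i by rewrite lt_neqAle eq_sym win0.
have Cyi : C (y i) by apply: Cy; rewrite ?mem_head.
move: S0; rewrite le_eqVlt => /predU1P[S0|S0] W0.
  rewrite -S0 addr0 [X in _ + X]big_seq big1 ?addr0 ?scalerA ?mulVf ?scale1r//.
  move=> j jr; suff -> : w j = 0 by rewrite scale0r.
  apply/eqP; move/esym/eqP: S0; rewrite big_seq psumr_eq0.
    by move/allP => /(_ j jr); rewrite jr.
  by move=> k kr; apply: w0; rewrite inE kr orbT.
have := @convex_setP _ _ _ Ccvx _ _ (w i / (w i + \sum_(j <- r) w j)) _ _ Cyi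
  (IH S0).
move: (\sum_(j <- r) w j) S0 W0 => S S0 W0.
have -> : 1 - w i / (w i + S) = S / (w i + S).
  by rewrite -[X in X - _](mulfV (lt0r_neq0 W0)) -mulrBl addrC addKr.
rewrite !scalerA scalerDr !scalerA.
rewrite (_ : S / (w i + S) / S = (w i + S)^-1); last first.
  by rewrite mulrAC mulfV ?mul1r ?lt0r_neq0.
rewrite [w i / _]mulrC; apply.
  by rewrite mulr_ge0 ?invr_ge0 ?ltW.
by rewrite mulrC ler_pdivrMr// mul1r lerDl ltW.
Qed.

(** The iteration behind Rådström's cancellation law.  Writing a + b_k as
    c_(k+1) + b_(k+1) with c_(k+1) in C and b_(k+1) of norm less than e, starting
    from b_0 = 0, and adding up the first n equations gives n a = n c + b_n with
    c the mean of the c_k.  Hence a is within e / n of C, for every n. *)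
Lemma ball_sub_convex_mean (R : realType) (E : normedModType R) (C : set E)
    (y : E) (r e : R) :
  convex_set C -> 0 < e -> e < r ->
  O_ball (@norm_metric R E) r y `<=` O_set (@norm_metric R E) e C ->
  forall (a : E) (n : nat), `|y - a| < r - e ->
  exists c b : E, [/\ C c, `|b| < e & a *+ n = c *+ n + b].
Proof.
move=> Ccvx e0 er yC a + aye.
have step b : `|b| < e -> exists c b', [/\ C c, `|b'| < e & a + b = c + b'].
  move=> be; have [|c Cc ce] := yC (a + b).
    rewrite /O_ball/= /norm_metric.
    rewrite addrAC.
    by rewrite (le_lt_trans (ler_normD _ _))// (distrC a); lra.
  exists c, (a + b - c); split => //.
  by rewrite [RHS]addrC subrK.
elim=> [|n [c [b [Cc be ab]]]].
  have [|c [b [Cc be _]]] := step 0; first by rewrite normr0.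
  by exists c, 0; rewrite normr0 !mulr0n addr0.
have [c' [b' [Cc' be' ab']]] := step _ be.
have n1 : n.+1%:R != 0 :> R by rewrite pnatr_eq0.
pose t : R := n%:R / n.+1%:R.
exists (t *: c + (1 - t) *: c'), b'; split => //.
  apply: convex_setP => //; first by rewrite divr_ge0.
  by rewrite ler_pdivrMr ?ltr0n// mul1r ler_nat.
(* the coefficients of c and c' become n and 1 *)
rewrite mulrS ab addrCA ab' addrA; congr (_ + _).
rewrite -[RHS]scaler_nat scalerDr !scalerA mulrBr /t mulr1 mulrCA mulfV// mulr1.
by rewrite scaler_nat -natr1 [n%:R + 1]addrC addrK scale1r.
Qed.

(** All points within r - e of y are limits of points of C, by the preceding
    lemma; so y is interior to the closure of the open convex set C, and such
    points belong to C.  Concretely, y lies on the segment between a point c0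
    of C and a point a slightly beyond y; replacing a by a close enough point c of C
    and moving c0 to compensate, within a ball contained in C, keeps y on the
    segment. *)
Lemma open_convex_cancel (R : realType) (E : normedModType R) (C : set E)
    (y : E) (r e : R) :
  open C -> convex_set C -> 0 < e -> e < r ->
  O_ball (@norm_metric R E) r y `<=` O_set (@norm_metric R E) e C -> C y.
Proof.
move=> Cop Ccvx e0 er yC; have mean := ball_sub_convex_mean Ccvx e0 er yC.
have [|c0 [_ [Cc0 _ _]]] := mean y 0%N; first by rewrite subrr normr0; lra.
have /nbhs_ballP[s /= s0 sC] := open_nbhs_nbhs (conj Cop Cc0).
(* so small that a below satisfies |y - a| < r - e *)
pose t : R := (r - e) / (`|y - c0| + 1).
have d0 : 0 < `|y - c0| + 1 by rewrite ltr_wpDl.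
have t0 : 0 < t by rewrite divr_gt0//; lra.
have st0 : 0 < s * t by exact: mulr_gt0.
pose a := y + t *: (y - c0).
pose n := (Num.bound (e / (s * t))).+1.
have [|c [b [Cc be ab]]] := mean a n.
  rewrite /a opprD addrA subrr add0r normrN normrZ gtr0_norm//.
  rewrite /t mulrAC ltr_pdivrMr// mulrDr mulr1; lra.
have n0 : (0 : R) < n%:R by rewrite ltr0n.
(* n is so large that e / n < s t, which makes the displacement of c0 below
   smaller than s *)
have acst : `|a - c| < s * t.
  have -> : a - c = n%:R^-1 *: b.
    apply: (scalerI (lt0r_neq0 n0)); rewrite scalerA mulfV ?lt0r_neq0// scale1r.
    by rewrite scaler_nat mulrnBl ab addrAC subrr add0r.
  rewrite normrZ gtr0_norm ?invr_gt0// mulrC ltr_pdivrMr// (lt_trans be)//.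
  rewrite mulrC -ltr_pdivrMr//.
  rewrite (lt_le_trans (archi_boundP _)) ?ler_nat//.
  by apply/ltW; exact: divr_gt0.
have Cc1 : C (c0 + t^-1 *: (a - c)).
  apply: sC; rewrite -ball_normE /ball_/= opprD addrA subrr add0r normrN.
  by rewrite normrZ gtr0_norm ?invr_gt0// mulrC ltr_pdivrMr.
have t1 : 0 < 1 + t by lra.
suff -> : y = (1 + t)^-1 *: c + (1 - (1 + t)^-1) *: (c0 + t^-1 *: (a - c)).
  apply: convex_setP => //; first by rewrite invr_ge0; lra.
  by rewrite invf_le1//; lra.
have -> : 1 - (1 + t)^-1 = (1 + t)^-1 * t.
  by rewrite -[X in X - _](mulVf (lt0r_neq0 t1)) mulrDr mulr1 addrAC subrr add0r.
rewrite -scalerA -scalerDr; apply: (scalerI (lt0r_neq0 t1)).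
rewrite scalerA mulfV ?lt0r_neq0// scale1r scalerDr scalerA mulfV ?lt0r_neq0//.
rewrite scale1r addrCA -[c + (a - c)]addrC subrK /a scalerDl scale1r scalerBr.
by rewrite addrCA [t *: c0 + _]addrC subrK.
Qed.

(** * Shrinking a point-finite open cover of a normal space *)

Lemma normal_interpolate (X : topologicalType) (K A : set X) :
  normal_space X -> closed K -> open A -> K `<=` A ->
  exists B, [/\ open B, K `<=` B & closure B `<=` A].
Proof.
move=> nX Kcl Aop KA; have [|N KN NA] := nX K Kcl A.
  by move=> x /KA Ax; exact: open_nbhs_nbhs.
exists N^°; split; first exact: open_interior.
  by move=> x Kx; exact: KN.
by apply: subset_trans NA; apply: closure_subset; exact: interior_subset.
Qed.

Lemma chain_finite_bound (T U : Type) (F : set (set U)) (Q : T -> set U -> Prop)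
    (s : set T) :
  F !=set0 -> total_on F subset ->
  (forall t S S', S `<=` S' -> Q t S -> Q t S') ->
  finite_set s -> (forall t, s t -> exists2 S, F S & Q t S) ->
  exists2 S, F S & forall t, s t -> Q t S.
Proof.
move=> [S0 FS0] Ftot Qmono sfin.
elim/Pchoice: T => T in Q s Qmono sfin *.
have /finite_seqP[r ->] := sfin.
elim: r => [|t r IH] rQ; first by exists S0.
have [|S FS SQ] := IH; first by move=> u ur; apply: rQ; rewrite /= inE ur orbT.
have [|S' FS' S'Q] := rQ t; first by rewrite /= mem_head.
have [SS'|S'S] := Ftot _ _ FS FS'; [exists S'|exists S] => // u /=.
  by rewrite inE => /predU1P[->//|/SQ]; exact: Qmono.
by rewrite inE => /predU1P[->|/SQ//]; exact: Qmono S'Q.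
Qed.

Section shrinking.
Context (X : topologicalType) (V : set (set X)) (nX : normal_space X)
  (Vcov : open_cover V) (Vfin : forall x, finite_set [set A | V A /\ A x]).

Let dom (S : set (set X * set X)) (A : set X) := exists B, S (A, B).

(** The members in the domain of S have been replaced by smaller open sets, the
    others are still themselves, and the result covers X.  Using a functional
    graph rather than a function turns extension into inclusion, the order for
    which Zorn's lemma is applied. *)
Definition partial_shrinking (S : set (set X * set X)) : Prop :=
  [/\ forall A B, S (A, B) -> [/\ V A, open B & closure B `<=` A],
      forall A B B', S (A, B) -> S (A, B') -> B = B' &
      forall x, (exists A B, S (A, B) /\ B x) \/
                (exists A, [/\ V A, A x & ~ dom S A])].

(** Point-finiteness is used here: if all the finitely many members containing x
    are shrunk in the union of the chain, they are already shrunk in one element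
    of the chain, and that element covers x. *)
Lemma partial_shrinking_bigcup (F : set (set (set X * set X))) :
  F `<=` partial_shrinking -> total_on F subset ->
  partial_shrinking (\bigcup_(S in F) S).
Proof.
move=> FP Ftot; split=> [A B [S FS SAB]|A B B' [S FS SB] [S' FS' SB']|x].
- by have [+ _ _] := FP _ FS; exact.
- have [SS'|S'S] := Ftot _ _ FS FS'.
    by have [_ + _] := FP _ FS'; apply; [exact: SS' SB|].
  by have [_ + _] := FP _ FS; apply; [exact: SB|exact: S'S].
apply: contrapT => /not_orP[nB nA].
have domF A : V A -> A x -> exists2 S, F S & dom S A.
  move=> VA Ax; apply: contrapT => ndom; apply: nA; exists A; split => //.
  by move=> [B [S FS SAB]]; apply: ndom; exists S => //; exists B.
have [A0 VA0 A0x] : (\bigcup_(A in V) A) x by have [_ ->] := Vcov.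
have [S0 FS0 _] := domF _ VA0 A0x.
have [|||S FS Sx] := @chain_finite_bound _ _ F (fun A S => dom S A) _ _ Ftot _
    (Vfin x).
- by exists S0.
- by move=> A S S' SS' [B SAB]; exists B; exact: SS'.
- by move=> A [VA Ax]; exact: domF.
have [_ _ /(_ x)[[A [B [SAB Bx]]]|[A [VA Ax]]]] := FP _ FS.
  by apply: nB; exists A, B; split => //; exists S.
by apply; exact: Sx.
Qed.

(** The points covered only by A form a closed subset of A, the complement of the
    open set U below; normality fits an open set B between the two. *)
Lemma partial_shrinking_extend (S : set (set X * set X)) (A : set X) :
  partial_shrinking S -> V A -> ~ dom S A ->
  exists B, partial_shrinking (S `|` [set (A, B)]).
Proof.
move=> [SV Sfun Scov] VA nSA; have [Vop _] := Vcov.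
pose U := [set x | (exists A' B, S (A', B) /\ B x) \/
                   (exists A', [/\ V A', A' <> A, A' x & ~ dom S A'])].
have Uop : open U.
  have -> : U = (\bigcup_(p in S) p.2) `|`
      (\bigcup_(A' in [set A' | [/\ V A', A' <> A & ~ dom S A']]) A').
    apply/seteqP; split=> x [].
    - by move=> [A' [B [SB Bx]]]; left; exists (A', B).
    - by move=> [A' [VA' A'A A'x nS]]; right; exists A'.
    - by move=> [[A' B] SB Bx]; left; exists A', B.
    - by move=> [A' [VA' A'A nS] A'x]; right; exists A'.
  apply: openU; apply: bigcup_open.
    by move=> [A' B] /SV[].
  by move=> A' [/Vop].
have [|B [Bop UB BA]] := normal_interpolate nX (open_closedC Uop) (Vop _ VA).
  move=> x nUx; have [[A' [B SB]]|[A' [VA' A'x nS]]] := Scov x.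
    by case: nUx; left; exists A', B.
  by have [<-//|A'A] := pselect (A' = A); case: nUx; right; exists A'.
exists B; split=> [A' B' [/SV//|[-> ->]]//|A' B1 B2|x].
  move=> [SB1|[eA ->]] [SB2|[eA' ->]] //; first exact: Sfun SB1 SB2.
    by case: nSA; exists B1; rewrite -eA'.
  by case: nSA; exists B2; rewrite -eA.
have [Bx|nBx] := pselect (B x); first by left; exists A, B; split => //; right.
have [[A' [B' [SB' B'x]]]|[A' [VA' A'A A'x nS]]] : U x.
    by apply: contrapT => nUx; apply: nBx; exact: UB.
  by left; exists A', B'; split => //; left.
right; exists A'; split => // -[B' [SB'|[/A'A]]]//.
by apply: nS; exists B'.
Qed.

Lemma shrinking : exists g : set X -> set X,
  (forall A, V A -> open (g A) /\ closure (g A) `<=` A) /\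
  \bigcup_(A in V) g A = [set: X].
Proof.
have [S [PS Smax]] := @Zorn_bigcup _ partial_shrinking partial_shrinking_bigcup.
have Sdom A : V A -> dom S A.
  move=> VA; apply: contrapT => nSA.
  have [B PB] := partial_shrinking_extend PS VA nSA.
  apply: (Smax _ _ PB); rewrite properEneq; split; last by move=> p; left.
  apply/eqP => SE; apply: nSA; exists B; rewrite SE.
  by right.
have /choice[g gP] : forall A, exists B, V A -> S (A, B).
  move=> A; have [/Sdom[B SB]|nVA] := pselect (V A); first by exists B.
  by exists set0.
have [SV Sfun Scov] := PS.
exists g; split=> [A VA|]; first by have [] := SV _ _ (gP _ VA).
apply/seteqP; split=> // x _.
have [[A [B [SB Bx]]]|[A [VA _ /(_ (Sdom _ VA))//]]] := Scov x.
have [VA _ _] := SV _ _ SB.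
by exists A => //; rewrite (Sfun _ _ _ (gP _ VA) SB).
Qed.

End shrinking.

(** * Partitions of unity *)

Lemma continuous_locally_finite_sum (R : realType) (E : normedModType R)
    (X : topologicalType) (I : choiceType) (V : set I) (h : I -> X -> E) :
  (forall i, V i -> continuous (h i)) ->
  (forall x : X, exists2 W : set X, nbhs x W &
     finite_set [set i | V i /\ exists2 z, W z & h i z != 0]) ->
  continuous (fun x => \sum_(i \in V) h i x).
Proof.
move=> hcont hfin x; have [W Wx Ffin] := hfin x.
set F := [set i | _] in Ffin.
have sumF z : W z -> \sum_(i \in V) h i z = \sum_(i <- fset_set F) h i z.
  move=> Wz; rewrite -fsbig_finite//; apply/esym/fsbig_widen => [i []//|].
  move=> i [Vi nFi] /=; apply: contrapT => /eqP hi; apply: nFi.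
  by split=> //; exists z.
have FV : {subset enum_fset (fset_set F) <= V}.
  by move=> i; rewrite -[_ \in _]/(i \in fset_set F) in_fset_set// !inE => -[].
have sum_cont : \sum_(i <- fset_set F) h i z @[z --> x] -->
    \sum_(i <- fset_set F) h i x.
  elim: (enum_fset _) FV => [|i r IH] rV.
    by rewrite big_nil; under eq_fun do rewrite big_nil; exact: cvg_cst.
  rewrite big_cons; under eq_fun do rewrite big_cons.
  apply: cvgD; first by apply: hcont; apply/set_mem/rV; rewrite mem_head.
  by apply: IH => j jr; apply: rV; rewrite inE jr orbT.
rewrite /continuous_at sumF; last exact: nbhs_singleton.
apply: cvg_trans sum_cont; apply: near_eq_cvg.
by apply: filterS Wx => z Wz; rewrite sumF.
Qed.

(** Bump functions equal to 1 on a shrinking of the cover have a sum that is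
    positive everywhere and, by local finiteness, continuous. *)
Lemma partition_of_unity (R : realType) (X : topologicalType)
    (V : set (set X)) :
  normal_space X -> open_cover V -> locally_finite V ->
  exists phi : set X -> X -> R,
    [/\ forall A, V A -> continuous (phi A),
        forall A x, V A -> 0 <= phi A x,
        forall A x, V A -> phi A x != 0 -> A x &
        forall x, \sum_(A \in V) phi A x = 1].
Proof.
move=> nX Vcov Vlf.
have Vfin x : finite_set [set A | V A /\ A x].
  have [W Wx] := Vlf x; apply: sub_finite_set => A [VA Ax]; split => //.
  by exists x; split => //; exact: nbhs_singleton.
have [g [gV gcov]] := shrinking nX Vcov Vfin.
have /choice[u uP] : forall A, exists u : X -> R, V A ->
    [/\ continuous u, forall x, 0 <= u x, forall x, u x != 0 -> A x &
        forall x, g A x -> 0 < u x].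
  move=> A; have [VA|nVA] := pselect (V A); last by exists (fun=> 0).
  have [_ gA] := gV _ VA; have [Vop _] := Vcov.
  have [|u [ucont u0 u1 u01]] := @urysohn_ext_itv X R nX (~` A)
      (closure (g A)) 0 1 (open_closedC (Vop _ VA)) (@closed_closure _ _) _ ltr01.
    by apply/seteqP; split=> // x [nAx /gA].
  exists u => _; split => //.
  - by move=> x; have /= := u01 _ (imageT u x); rewrite in_itv/= => /andP[].
  - move=> x; apply: contra_neqP => nAx; exact: u0 (imageP u nAx).
  - move=> x gx; have /= -> := u1 _ (imageP u (subset_closure gx)).
    exact: ltr01.
pose s x := \sum_(A \in V) u A x.
have ulf (h : set X -> X -> R) : (forall A x, V A -> h A x != 0 -> A x) ->
    forall x : X, exists2 W : set X, nbhs x W &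
      finite_set [set A | V A /\ exists2 z, W z & h A z != 0].
  move=> hV x; have [W Wx Wfin] := Vlf x; exists W => //.
  apply: sub_finite_set Wfin => A [VA [z Wz hz]]; split => //.
  by exists z; split => //; exact: hV hz.
have uV A x : V A -> u A x != 0 -> A x.
  by move=> VA; have [_ _ + _] := uP _ VA; exact.
have scont : continuous s.
  apply: (@continuous_locally_finite_sum R R^o) => [A VA|]; last exact: ulf.
  by have [] := uP _ VA.
have s0 x : 0 < s x.
  have [A VA gAx] : (\bigcup_(A in V) g A) x by rewrite gcov.
  have [_ _ _ /(_ _ gAx) uAx] := uP _ VA.
  rewrite /s -(@fsbig_widen _ _ _ _ [set A | V A /\ A x] V)/=; last first.
  - move=> B [VB nBx] /=; apply/eqP; apply: contra_notT nBx => /uV Bx.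
    by split => //; exact: Bx.
  - by move=> B [].
  rewrite (fsbigD1 A)//=; last first.
    by split => //; apply: uV => //; rewrite gt_eqF.
  rewrite ltr_pwDl// fsumr_ge0// => B [[VB _] _].
  by have [_ + _ _] := uP _ VB; exact.
exists (fun A x => (s x)^-1 * u A x); split.
- move=> A VA x; apply: cvgM; last by have [+ _ _ _] := uP _ VA; exact.
  by apply: cvgV => //; [rewrite gt_eqF|exact: scont].
- move=> A x VA; have [_ u0 _ _] := uP _ VA.
  by rewrite mulr_ge0 ?invr_ge0 ?(ltW (s0 _)).
- by move=> A x VA; rewrite mulf_eq0 negb_or => /andP[_]; exact: uV.
- by move=> x; rewrite -mulr_fsumr mulVf// gt_eqF.
Qed.

(** * The selection *)

(** Semicontinuity that is uniform in the points of Phi p puts the whole ball of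
    radius r about y within r / 2 of Phi x, and cancellation applies. *)
Lemma lsc_open_convex_interior (R : realType) (X : topologicalType)
    (E : normedModType R) (Phi : X -> set E) (p : X) (y : E) :
  open_convex_valued Phi -> rho_lsc (@norm_metric R E) Phi ->
  Phi p y -> nbhs p [set x | Phi x y].
Proof.
move=> oc lsc Py; have [Pop _] := oc p.
have /nbhs_ballP[r /= r0 rP] := open_nbhs_nbhs (conj Pop Py).
have r20 : 0 < r / 2 by rewrite divr_gt0.
have [V [Vop Vp VP]] := lsc _ r20 p.
apply: filterS (open_nbhs_nbhs (conj Vop Vp)) => x Vx /=.
have [xop xcvx] := oc x.
apply: (@open_convex_cancel _ _ _ _ r (r / 2)) => //; first by lra.
apply: subset_trans (VP _ Vx) => z; rewrite /O_ball/= /norm_metric => zy.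
by apply: rP; rewrite -ball_normE /ball_/= distrC // distrC.
Qed.

Theorem corollary2p3 (tau : Type) (htau : infinite_set [set: tau])
    (X : topologicalType) (hX : hausdorff_space X) (nX : normal_space X)
    (pX : tau_paracompact tau X)
    (R : realType) (E : normedModType R) (dE : density_le E tau)
    (Phi : X -> set E) (nePhi : nonempty_valued Phi)
    (ocPhi : open_convex_valued Phi)
    (lscPhi : rho_lsc (@norm_metric R E) Phi) :
  exists f : X -> E, continuous f /\ forall x, Phi x (f x).
Proof.
have /density_leP[D Ddense Dtau] := dE.
pose O y := [set x | Phi x y].
have Oop y : open (O y).
  by rewrite openE => p; exact: lsc_open_convex_interior.
have [||V [Vcov Vref Vlf]] := pX (O @` D).
- split=> [_ [y _ <-]//|]; apply/seteqP; split=> // x _.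
  have [y [Pxy Dy]] := Ddense _ (nePhi x) (ocPhi x).1.
  by exists (O y) => //; exists y.
- exact: card_le_trans (card_image_le _ _) Dtau.
have /choice[y yP] : forall A, exists y, V A -> A `<=` O y.
  move=> A; have [/Vref[_ [y _ <-] Ay]|nVA] := pselect (V A); first by exists y.
  by exists 0.
have [phi [phicont phi0 phiV phi1]] := @partition_of_unity R X V nX Vcov Vlf.
exists (fun x => \sum_(A \in V) phi A x *: y A); split.
  apply: continuous_locally_finite_sum => [A VA x|x].
    by apply: continuousZl; exact: phicont.
  have [W Wx Wfin] := Vlf x; exists W => //.
  apply: sub_finite_set Wfin => A [VA [z Wz]].
  rewrite scaler_eq0 negb_or => /andP[phiz _]; split => //.
  by exists z; split => //; exact: phiV phiz.
move=> x; pose F := [set A | V A /\ phi A x != 0].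
have Ffin : finite_set F.
  have [W Wx] := Vlf x; apply: sub_finite_set => A [VA /phiV Ax]; split => //.
  by exists x; split; [exact: Ax|exact: nbhs_singleton].
have FV : F `<=` V by move=> A [].
have F0 : V `\` F `<=` [set A | phi A x = 0].
  move=> A [VA nFA] /=; apply/eqP; apply: contra_notT nFA => ?; exact: conj.
have sumF : \sum_(A <- fset_set F) phi A x = 1.
  by rewrite -fsbig_finite// -(phi1 x); exact: fsbig_widen.
rewrite -(@fsbig_widen _ _ _ _ F)//; last first.
  by move=> A /F0 /= ->; rewrite scale0r.
(* the total weight is 1 *)
rewrite fsbig_finite// -[X in Phi x X]scale1r -[X in X *: _]invr1.
rewrite -[in X in X *: _]sumF.
apply: convex_mean.
- by have [] := ocPhi x.
- by move=> A; rewrite in_fset_set// inE => -[VA _]; exact: phi0.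
- move=> A; rewrite in_fset_set// inE => -[VA phiA] _.
  by apply: (yP _ VA); exact: phiV phiA.
- by rewrite sumF.
Qed.
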